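(* Let $C$ be a commutative group with unit element $e$ and let $A, B$ be subgroups of $C$. Then the following three conditions are equivalent: (i) $A$ and $B$ are subgroup-independent in $C$; (ii) $A\cap B=\{e\}$; (iii) $A\vee B\cong A\oplus B$, i.e. the canonical homomorphism $q: A\oplus B\to A\vee B$ is an isomorphism.
   Context: For subgroups $A,B$ of $C$, $A\vee B$ denotes the subgroup of $C$ generated by $A\cup B$. $A$ and $B$ are subgroup-independent in $C$ if for any group homomorphisms $\alpha: A\to A$ and $\beta: B\to B$ there is a group homomorphism $\gamma: A\vee B\to A\vee B$ such that $\gamma(a)=\alpha(a)$ for all $a\in A$ and $\gamma(b)=\beta(b)$ for all $b\in B$. $A\oplus B$ denotes the coproduct (direct sum) of $A$ and $B$ in the category of commutative groups, and $q: A\oplus B\to A\vee B$ is the canonical homomorphism induced by the inclusions $A\hookrightarrow A\vee B$ and $B\hookrightarrow A\vee B$. *)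

(* Defs.v *)
From HB Require Import structures.
From mathcomp Require Import all_boot all_algebra.
From mathcomp Require Import boolp.

Set Implicit Arguments.
Unset Strict Implicit.
Unset Printing Implicit Defensive.

Import GRing.Theory.
Local Open Scope ring_scope.

(* A commutative group is a [zmodType], written additively, so that the unit  *)
(* element e is 0; a subgroup is a [zmodClosed] predicate. Classical logic    *)
(* ([`[< _ >]] from boolp) makes every Prop-valued subgroup such a predicate. *)

Section Subgroups.
Variable C : zmodType.

Record subgroup_of (D : zmodClosed C) : Type :=
  SubgroupOf { sgval : C; _ : sgval \in D }.

HB.instance Definition _ (D : zmodClosed C) := [isSub for @sgval D].
HB.instance Definition _ (D : zmodClosed C) :=
  [Choice of subgroup_of D by <:].
HB.instance Definition _ (D : zmodClosed C) :=
  [SubChoice_isSubZmodule of subgroup_of D by <:].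

Definition generated (S : {pred C}) : pred C :=
  fun x => `[< forall D : zmodClosed C, {subset S <= D} -> x \in D >].

Lemma generated_zmod_closed (S : {pred C}) : zmod_closed (generated S).
Proof.
split=> [|x y /asboolP hx /asboolP hy]; apply/asboolP=> D sSD.
  exact: rpred0.
by apply: rpredB; [exact: hx | exact: hy].
Qed.

HB.instance Definition _ (S : {pred C}) :=
  GRing.isZmodClosed.Build C (generated S) (generated_zmod_closed S).

Lemma sub_generated (S : {pred C}) : {subset S <= generated S}.
Proof. by move=> x Sx; apply/asboolP=> D; apply. Qed.

Definition join (A B : zmodClosed C) : zmodClosed C :=
  GRing.ZmodClosed.clone C (generated [predU A & B]) _.

Lemma sub_joinl (A B : zmodClosed C) : {subset A <= join A B}.
Proof. by move=> x Ax; apply: sub_generated; rewrite inE Ax. Qed.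

Lemma sub_joinr (A B : zmodClosed C) : {subset B <= join A B}.
Proof. by move=> x Bx; apply: sub_generated; rewrite inE Bx orbT. Qed.

Section Inclusion.
Variables (D E : zmodClosed C) (sDE : {subset D <= E}).

Definition inclusion (x : subgroup_of D) : subgroup_of E :=
  SubgroupOf (sDE (valP x)).

Lemma inclusion_is_zmod_morphism : zmod_morphism inclusion.
Proof. by move=> x y; apply: val_inj; rewrite raddfB. Qed.

HB.instance Definition _ :=
  GRing.isZmodMorphism.Build (subgroup_of D) (subgroup_of E) inclusion
    inclusion_is_zmod_morphism.
End Inclusion.

Definition inl_join (A B : zmodClosed C) :
    {additive subgroup_of A -> subgroup_of (join A B)} :=
  inclusion (@sub_joinl A B).

Definition inr_join (A B : zmodClosed C) :
    {additive subgroup_of B -> subgroup_of (join A B)} :=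
  inclusion (@sub_joinr A B).

Definition subgroup_independent (A B : zmodClosed C) : Prop :=
  forall (alpha : {additive subgroup_of A -> subgroup_of A})
         (beta : {additive subgroup_of B -> subgroup_of B}),
  exists gamma : {additive subgroup_of (join A B) -> subgroup_of (join A B)},
    (forall a : subgroup_of A, gamma (inl_join A B a) = inl_join A B (alpha a))
    /\
    (forall b : subgroup_of B, gamma (inr_join A B b) = inr_join A B (beta b)).

End Subgroups.

(* The coproduct of U and V is the product zmodType [U * V] with the          *)
(* injections below; [copairingP] is its universal property.                  *)
Section Coproduct.
Variables U V : zmodType.

Definition coprod_inl (u : U) : U * V := (u, 0).
Definition coprod_inr (v : V) : U * V := (0, v).

Lemma coprod_inl_is_zmod_morphism : zmod_morphism coprod_inl.
Proof. by move=> x y; congr pair; rewrite /= subrr. Qed.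

Lemma coprod_inr_is_zmod_morphism : zmod_morphism coprod_inr.
Proof. by move=> x y; congr pair; rewrite /= subrr. Qed.

HB.instance Definition _ :=
  GRing.isZmodMorphism.Build U (U * V)%type coprod_inl
    coprod_inl_is_zmod_morphism.
HB.instance Definition _ :=
  GRing.isZmodMorphism.Build V (U * V)%type coprod_inr
    coprod_inr_is_zmod_morphism.

Section Copairing.
Variables (W : zmodType) (f : {additive U -> W}) (g : {additive V -> W}).

Definition copairing (p : U * V) : W := f p.1 + g p.2.

Lemma copairing_is_zmod_morphism : zmod_morphism copairing.
Proof. by move=> x y; rewrite /copairing !raddfB /= opprD addrACA. Qed.

HB.instance Definition _ :=
  GRing.isZmodMorphism.Build (U * V)%type W copairing
    copairing_is_zmod_morphism.

Lemma copairingP (h : {additive (U * V)%type -> W}) :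
  (forall u, h (coprod_inl u) = f u) /\ (forall v, h (coprod_inr v) = g v)
  <-> h =1 copairing.
Proof.
split=> [[hl hr] [u v]|hE].
  rewrite /copairing /= -hl -hr -raddfD.
  by congr (h _); congr pair; rewrite /= ?addr0 ?add0r.
by split=> x; rewrite hE /copairing /= raddf0 ?addr0 ?add0r.
Qed.
End Copairing.
End Coproduct.

Definition canonical_hom (C : zmodType) (A B : zmodClosed C) :
    {additive (subgroup_of A * subgroup_of B)%type ->
              subgroup_of (join A B)} :=
  copairing (inl_join A B) (inr_join A B).

Definition is_group_iso (U V : zmodType) (f : {additive U -> V}) : Prop :=
  exists g : {additive V -> U}, cancel f g /\ cancel g f.

(* Main.v *)
Require Import Defs.
From HB Require Import structures.
From mathcomp Require Import all_boot all_algebra.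
From mathcomp Require Import boolp.

(** Everything goes through the canonical homomorphism q, (a, b) |-> a + b.
    It is always surjective, since the sums a + b form a subgroup containing
    A and B ([canonical_hom_surj]); and it is injective exactly when A and B
    meet trivially, because a + b = 0 puts a = - b in the intersection, while
    a common element x gives q (x, - x) = 0 ([canonical_hom_injP]).  Hence
    trivial intersection is the same as q being an isomorphism.

    If q is an isomorphism, the join inherits the universal property of the
    coproduct, so the pair of alpha and beta, viewed as maps into the join,
    extends to it.  Conversely, independence applied to the identity of A and
    the zero endomorphism of B gives a map of the join that both fixes and
    kills every common element of A and B. *)

Import GRing.Theory.
Local Open Scope ring_scope.

(** The inverse is additive for free, so bijectivity is the whole content of
    being an isomorphism. *)
Lemma is_group_iso_bij (U V : zmodType) (f : {additive U -> V}) :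
  injective f -> (forall v, exists u, f u == v) -> is_group_iso f.
Proof.
move=> f_inj f_surj; pose g v := xchoose (f_surj v).
have gK : cancel g f by move=> v; apply/eqP/(xchooseP (f_surj v)).
have fK : cancel f g by move=> u; apply: f_inj; rewrite gK.
have g_add : zmod_morphism g.
  by move=> x y; apply: f_inj; rewrite raddfB !gK.
pose G := GRing.isZmodMorphism.Build V U g g_add.
pose h : {additive V -> U} := HB.pack g G.
by exists h.
Qed.

Section SumsOfSubgroups.
Variables (C : zmodType) (A B : zmodClosed C).

Definition sums : pred C :=
  fun x => `[< exists a b, [/\ a \in A, b \in B & x = a + b] >].

Lemma sums_zmod_closed : zmod_closed sums.
Proof.
split=> [|_ _ /asboolP[a [b [Aa Bb ->]]] /asboolP[a' [b' [Aa' Bb' ->]]]].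
  by apply/asboolP; exists 0, 0; rewrite !rpred0 addr0.
apply/asboolP; exists (a - a'), (b - b').
by rewrite !rpredB // opprD addrACA.
Qed.

HB.instance Definition _ := GRing.isZmodClosed.Build C sums sums_zmod_closed.

(** The join is contained in every subgroup containing A and B, and the sums
    form one. *)
Lemma join_sums : {subset join A B <= sums}.
Proof.
move=> x /asboolP; apply=> y; rewrite inE => /orP[Ay|By]; apply/asboolP.
  by exists y, 0; rewrite rpred0 addr0.
by exists 0, y; rewrite rpred0 add0r.
Qed.

Lemma canonical_hom_surj v : exists u, canonical_hom A B u == v.
Proof.
have /asboolP[a [b [Aa Bb vE]]] := join_sums _ (valP v).
exists (SubgroupOf Aa, SubgroupOf Bb).
by apply/eqP/val_inj; rewrite raddfD vE.
Qed.

Lemma canonical_hom_injP :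
  [predI A & B] =i pred1 (0 : C) <-> injective (canonical_hom A B).
Proof.
split=> [AB0|q_inj x].
  apply: raddf_inj => -[a b] /(congr1 val); rewrite raddfD /= => ab0.
  have aE : val a = - val b by apply/eqP; rewrite -addr_eq0; apply/eqP.
  have : val a \in [predI A & B].
    by rewrite inE /= (valP a) aE rpredN (valP b).
  rewrite AB0 inE => /eqP a0.
  have b0 : val b = 0 by rewrite -[val b]opprK -aE a0 oppr0.
  by congr pair; apply: val_inj; rewrite ?a0 ?b0 raddf0.
apply/idP/eqP=> [/andP[/= Ax Bx]|->]; last by rewrite inE /= !rpred0.
(* A common element x would make (x, - x) a kernel element. *)
have : canonical_hom A B (SubgroupOf Ax, - SubgroupOf Bx)
       = canonical_hom A B 0.
  by apply: val_inj; rewrite raddf0 raddfD; exact: subrr.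
by move/q_inj/(congr1 (fun p => val p.1)) => /= ->.
Qed.

Lemma trivial_meet_isoP :
  [predI A & B] =i pred1 (0 : C) <-> is_group_iso (canonical_hom A B).
Proof.
rewrite canonical_hom_injP; split=> [q_inj|[g [qK _]]]; last exact: can_inj qK.
exact: is_group_iso_bij q_inj canonical_hom_surj.
Qed.

(** Transported along q, the required extension is the copairing of alpha and
    beta composed with the inclusions into the join. *)
Lemma iso_independent :
  is_group_iso (canonical_hom A B) -> subgroup_independent A B.
Proof.
move=> [g [qK _]] alpha beta.
pose h : {additive _ -> _} :=
  copairing (inl_join A B \o alpha) (inr_join A B \o beta).
have [hl hr] := (copairingP _ _ h).2 (frefl _).
have [ql qr] := (copairingP _ _ (canonical_hom A B)).2 (frefl _).
exists (h \o g); split=> [a|b] /=; first by rewrite -ql qK hl.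
by rewrite -qr qK hr.
Qed.

(** The identity of A and the zero endomorphism of B have incompatible values
    at any nonzero common element. *)
Lemma independent_trivial_meet :
  subgroup_independent A B -> [predI A & B] =i pred1 (0 : C).
Proof.
move=> indep x; apply/idP/eqP=> [/andP[/= Ax Bx]|->]; last first.
  by rewrite inE /= !rpred0.
have [gamma [fixA killB]] := indep idfun \0.
have := fixA (SubgroupOf Ax).
(* The two inclusions of x in the join agree as elements of C. *)
have -> : inl_join A B (SubgroupOf Ax) = inr_join A B (SubgroupOf Bx).
  exact: val_inj.
by rewrite killB raddf0 => /(congr1 val) /= <-.
Qed.

End SumsOfSubgroups.

Theorem proposition2p10 (C : zmodType) (A B : zmodClosed C) :
  (subgroup_independent A B <-> [predI A & B] =i pred1 (0 : C)) /\
  ([predI A & B] =i pred1 (0 : C) <-> is_group_iso (canonical_hom A B)).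
Proof.
split; last exact: trivial_meet_isoP.
split; first exact: independent_trivial_meet.
by move/trivial_meet_isoP/iso_independent.
Qed.
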